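(* Let $d \geq 1$ and let $X_1,\ldots,X_n,Y_1,\ldots,Y_n$ be random variables with values in $[0,1]^d$ such that the couples $(X_1,Y_1),\ldots,(X_n,Y_n)$ are pairwise independent and, for every $k=1,\ldots,n$, $X_k$ and $Y_k$ have the same distribution. For the empirical measures $\mu_n = \frac1n\sum_{k=1}^n \delta_{X_k}$ and $\nu_n = \frac1n\sum_{k=1}^n\delta_{Y_k}$, $$ \mathbb{E}\big(\mathrm{W}_1(\mu_n,\nu_n)\big) = \begin{cases} O\big(\frac{1}{\sqrt n}\big) & \text{if } d=1,\\ O\Big(\sqrt{\frac{\log n}{n}}\Big) & \text{if } d=2,\\ O\big(\frac{1}{n^{1/d}}\big) & \text{if } d\geq 3. \end{cases} $$
   Context: For Borel probability measures $\mu,\nu$ on $\mathbb{R}^d$ with finite first moment, $\mathrm{W}_1(\mu,\nu)=\inf_\lambda \int_{\mathbb{R}^d}\int_{\mathbb{R}^d}|x-y|\,d\lambda(x,y)$, where the infimum is over all probability measures $\lambda$ on $\mathbb{R}^d\times\mathbb{R}^d$ with marginals $\mu$ and $\nu$, and $|\cdot|$ is the Euclidean norm. Here $n\geq 2$ is an integer, and $O(\cdot)$ means: bounded by a constant depending only on $d$ times the indicated quantity, uniformly in $n \ge 2$ and in the random variables satisfying the hypotheses. The variables $X_k$ and $Y_k$ within the same couple may be dependent, and the distribution of $X_k$ may depend on $k$. *)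

(* Defs.v *)
From HB Require Import structures.
From mathcomp Require Import all_boot all_order all_algebra.
From mathcomp Require Import all_classical all_reals all_analysis.
Import Order.TTheory GRing.Theory Num.Theory.
Import numFieldNormedType.Exports.

Set Implicit Arguments.
Unset Strict Implicit.
Unset Printing Implicit Defensive.

Local Open Scope classical_set_scope.
Local Open Scope ring_scope.

(* Points of R^d are elements of [d.-tuple R]: the sigma-algebra of this type
   is generated by the coordinate projections, i.e. it is the Borel one. *)

Definition eucl_dist (R : realType) (d : nat) (x y : d.-tuple R) : R :=
  Num.sqrt (\sum_(i < d) (tnth x i - tnth y i) ^+ 2).

Definition unit_cube (R : realType) (d : nat) : set (d.-tuple R) :=
  [set x | forall i : 'I_d, 0 <= tnth x i <= 1].
Arguments unit_cube : clear implicits.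

(* Laws are only ever compared on measurable sets: the values that a measure
   function takes on other sets carry no information. *)
Definition couplings (R : realType) (d : nat)
    (mu nu : probability (d.-tuple R) R) :
    set (probability (d.-tuple R * d.-tuple R)%type R) :=
  [set lambda | (forall A, measurable A -> lambda (A `*` setT) = mu A) /\
                (forall B, measurable B -> lambda (setT `*` B) = nu B)].

(* Defined for all probability measures; it is finite when both have a finite
   first moment. *)
Definition W1 (R : realType) (d : nat) (mu nu : probability (d.-tuple R) R) :
    \bar R :=
  ereal_inf [set (\int[lambda]_z (eucl_dist z.1 z.2)%:E)%E
            | lambda in couplings mu nu].

(* The argument [0 < n] serves to make the empirical measure of n points a
   probability measure. *)
Definition empirical (R : realType) (disp : measure_display)
    (V : measurableType disp) (n : nat) (n_gt0 : (0 < n)%N) (x : 'I_n -> V) :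
    set V -> \bar R :=
  fun A => ((n%:R^-1)%:E * \sum_(k < n) \d_(x k) A)%E.

Arguments empirical {R disp V n} n_gt0 x.

Section empirical_probability.
Local Open Scope ereal_scope.
Context (R : realType) (disp : measure_display) (V : measurableType disp).
Context (n : nat) (n_gt0 : (0 < n)%N) (x : 'I_n -> V).

Local Notation emp := (@empirical R _ _ _ n_gt0 x).

Let emp0 : emp set0 = 0.
Proof. by rewrite /empirical big1 ?mule0// => k _; rewrite measure0. Qed.

Let emp_ge0 A : 0 <= emp A.
Proof.
apply: mule_ge0; first by rewrite lee_fin invr_ge0.
by apply: sume_ge0 => k _; exact: measure_ge0.
Qed.

Let emp_sigma_additive : semi_sigma_additive emp.
Proof.
have c_ge0 : (0 <= n%:R^-1 :> R)%R by rewrite invr_ge0.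
pose m (k : nat) : {measure set V -> \bar R} :=
  [the measure V R of \d_(x (odflt (Ordinal n_gt0) (insub k)))].
have -> : emp = mscale (NngNum c_ge0) (msum m n).
  apply/funext => A; rewrite /empirical /mscale /msum/=; congr (_ * _).
  by apply: eq_bigr => k _; rewrite /m /= valK.
exact: measure_semi_sigma_additive.
Qed.

HB.instance Definition _ := isMeasure.Build _ _ _ emp
  emp0 emp_ge0 emp_sigma_additive.

Let emp_setT : emp setT = 1.
Proof.
rewrite /empirical (eq_bigr (fun=> 1%:E)); last first.
  by move=> k _; rewrite diracT.
rewrite sumEFin sumr_const card_ord -EFinM mulVf// pnatr_eq0.
by rewrite -lt0n.
Qed.

HB.instance Definition _ := Measure_isProbability.Build _ _ _ emp emp_setT.

End empirical_probability.

Section random_variables.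
Context (R : realType) (disp disp' : measure_display).
Context (T : measurableType disp) (V : measurableType disp').
Context (P : probability T R).

Definition same_distribution (X Y : {RV P >-> V}) : Prop :=
  forall A, measurable A -> distribution P X A = distribution P Y A.

Definition independent_RVs (X Y : T -> V) : Prop :=
  forall A B, measurable A -> measurable B ->
    P (X @^-1` A `&` Y @^-1` B) = (P (X @^-1` A) * P (Y @^-1` B))%E.

Definition pairwise_independent (I : eqType) (Z : I -> T -> V) : Prop :=
  forall j k, j != k -> independent_RVs (Z j) (Z k).

End random_variables.

Definition transport_rate (R : realType) (d n : nat) : R :=
  if d == 1%N then 1 / Num.sqrt n%:R
  else if d == 2%N then Num.sqrt (ln n%:R / n%:R)
  else 1 / (n%:R `^ (1 / d%:R)).

(* Main.v *)
Require Import Defs.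
From mathcomp Require Import all_boot all_order all_algebra perm.
From mathcomp Require Import all_classical all_reals all_analysis.
From mathcomp Require Import measurable_realfun ring lra zify.
Import Order.TTheory GRing.Theory Num.Theory.
Import numFieldNormedType.Exports.

Local Open Scope classical_set_scope.
Local Open Scope ring_scope.
Set Implicit Arguments.
Unset Strict Implicit.
Unset Printing Implicit Defensive.

(** Optimal transport between two clouds of [n] points is an assignment problem,
    so linear programming duality bounds the cost by an average of differences
    F(X_k) - F(Y_k) of one Lipschitz function ([W1_le_potential]).  To control
    all such F at once, cut the cube into N^d cells with N = 2^L and attach to
    each cell z a unit flow on the edges of the grid, transporting the point
    mass at z to the uniform distribution.  Summation by parts
    ([flow_divergence]) turns F(X_k) - F(Y_k) into the sum, over the edges, of
    the increments of F, which are at most 1/N, times the difference of the two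
    flows.  Up to the rounding error 2d/N, this gives ([W1_le_net_flow])

      W1 <= 1/N * sum_e |1/n * sum_k (flow_(X_k)(e) - flow_(Y_k)(e))|.

    For each edge e the terms indexed by k are centred, because X_k and Y_k have
    the same law, and pairwise uncorrelated, because the couples are pairwise
    independent.  Hence their variances add up ([mean_sqr_sum]), and the
    expected cost is governed by the number d N^d of edges and by the energy
    sum_e flow_z(e)^2 ([expected_W1_le]).

    The flow passes through the uniform distributions on the dyadic cubes
    around z, of sides 1, 2, 4, up to N.  At scale j a unit mass travels a
    distance of order 2^j, and is spread over about 2^(jd) points, so an edge
    carries at most 2^(-j(d-1)) ([usage_le]) and the edges together carry at
    most 2^(j+1) in each direction ([sum_usage]).  Bounding each product of two
    scales by the maximum of the coarser one times the sum of the finer one,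
    the energy is at most of order sum_j 2^j / 2^(j(d-1)) ([flow_energy]), that
    is, N if d = 1, L if d = 2, and a constant if d >= 3.  With N^d comparable
    to n this yields the three rates.  In dimension 2 it is essential to add up
    the scales inside the square: adding up the expected costs of the scales
    would give log n / sqrt n instead of sqrt (log n / n). *)

(** * Duality for the assignment problem *)
Fixpoint walk_weight {R : realDomainType} {I : finType} (w : I -> I -> R)
    (x : I) (s : seq I) : R :=
  if s is y :: s' then w x y + walk_weight w y s' else 0.

Lemma walk_weight_cat {R : realDomainType} {I : finType} (w : I -> I -> R) x s t :
  walk_weight w x (s ++ t) = walk_weight w x s + walk_weight w (last x s) t.
Proof. by elim: s x => [|y s IH] x /=; rewrite ?add0r// IH addrA. Qed.

Lemma walk_weight_nth {R : realDomainType} {I : finType} (w : I -> I -> R) x0 x s :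
  walk_weight w x s = \sum_(k < size s) w (nth x0 (x :: s) k) (nth x0 s k).
Proof.
elim: s x => [|y s IH] x /=; first by rewrite big_ord0.
by rewrite big_ord_recl IH.
Qed.

(** A cycle is a permutation moving each of its points to the next one; this is
    how the optimality of an assignment bears on closed walks. *)
Lemma cycle_weight_next {R : realDomainType} {I : finType} (w : I -> I -> R) x s :
  uniq (x :: s) ->
  walk_weight w x (rcons s x) = \sum_(y <- x :: s) w y (next (x :: s) y).
Proof.
move=> Us; rewrite (walk_weight_nth w x) (big_nth x) big_mkord size_rcons.
apply: eq_bigr => k _; have ks : (k < size (x :: s))%N by [].
rewrite -rcons_cons nth_rcons ks; congr w.
rewrite next_nth mem_nth// index_uniq// nth_rcons.
move: ks; rewrite /= ltnS; case: ltngtP => // -> _.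
by rewrite nth_default.
Qed.

(** Rerouting an optimal assignment along a cycle cannot lower its cost, so the
    graph of the reassignment costs has no negative cycle. *)
Lemma optimal_cycle_ge0 {R : realDomainType} {I : finType}
    (c : I -> I -> R) (s : {perm I}) :
  (forall t : {perm I}, \sum_i c i (s i) <= \sum_i c i (t i)) ->
  forall x p, uniq (x :: p) ->
    0 <= walk_weight (fun i j => c i (s j) - c i (s i)) x (rcons p x).
Proof.
move=> s_opt x p Up; rewrite cycle_weight_next//.
pose t := perm (can_inj (prev_next Up)).
have := s_opt (t * s)%g; rewrite -subr_ge0 -sumrB => /le_trans; apply.
rewrite [leRHS]big_uniq//= (bigID [pred i | i \in x :: p])/= [X in _ + X]big1 ?addr0.
  by apply: ler_sum => i ip; rewrite permM permE.
move=> i ip; rewrite permM permE next_nth (negbTE ip).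
exact: subrr.
Qed.

(** Without negative cycles, shortest walks exist and their weights form a
    potential: this is the dual solution, and complementary slackness holds
    along the optimal assignment. *)
Lemma assignment_duality {R : realDomainType} {I : finType} (c : I -> I -> R) :
  exists (s : {perm I}) (u v : I -> R),
    (forall i j, u i - v j <= c i j) /\
    \sum_i c i (s i) = \sum_i u i - \sum_i v i.
Proof.
pose s : {perm I} := [arg min_(t < (1%g : {perm I})) \sum_i c i (t i)]%O.
have s_opt (t : {perm I}) : \sum_i c i (s i) <= \sum_i c i (t i).
  by rewrite /s; case: arg_minP => // r _; apply.
pose w i j := c i (s j) - c i (s i).
have cyc := @optimal_cycle_ge0 R I c s s_opt; rewrite -/w in cyc.
pose best i : #|I|.-bseq I :=
  [arg min_(p < ([bseq] : #|I|.-bseq I) | uniq (i :: p)) walk_weight w i p]%O.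
have bestP i : uniq (i :: best i) /\
    forall p, uniq (i :: p) -> walk_weight w i (best i) <= walk_weight w i p.
  rewrite /best; case: arg_minP => //= q Uq minq; split=> // p Up.
  have sp : (size p <= #|I|)%N.
    by rewrite -(card_uniqP (proj2 (andP Up))) max_card.
  exact: (minq (Bseq sp)).
pose b i := walk_weight w i (best i).
(* Prepending i to a shortest walk from j gives a walk from i; if that walk
   already visits i, cutting off the closed part does not raise its weight. *)
have b_step i j : b i <= w i j + b j.
  have [Uj minj] := bestP j; have [Ui mini] := bestP i.
  have [iP|iP] := boolP (i \in j :: best j); last first.
    by apply: (mini (j :: best j)); rewrite cons_uniq iP.
  have [ij|nij] := eqVneq i j.
    by rewrite -ij /w subrr add0r.
  rewrite inE (negbTE nij)/= in iP.
  rewrite {2}/b; case/splitPr: iP Uj => p1 p2 Uj.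
  have -> : walk_weight w j (p1 ++ i :: p2) =
      walk_weight w j (rcons p1 i) + walk_weight w i p2.
    by rewrite -cat_rcons walk_weight_cat last_rcons.
  have Ui2 : uniq (i :: p2).
    by move: Uj; rewrite /= cat_uniq => /andP[_] /and3P[_ _].
  have Uc : uniq (i :: j :: p1).
    have : uniq ((j :: p1) ++ i :: p2) by [].
    rewrite cat_uniq => /and3P[Ujp /hasPn/(_ i)/[!mem_head]/(_ isT) ni _].
    by rewrite cons_uniq Ujp andbT.
  have := cyc _ _ Uc; rewrite /= => c0; have := mini _ Ui2; rewrite -/(b i) => bp.
  by rewrite addrA; apply: le_trans bp _; rewrite lerDr.
exists s, (fun i => c i (s i) + b i), (fun j => b ((s^-1)%g j)); split.
  move=> i j; have := b_step i ((s^-1)%g j); rewrite /w permKV.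
  by rewrite -subr_ge0 => h; rewrite -subr_ge0 (le_trans h)// le_eqVlt; apply/orP; left; apply/eqP; ring.
rewrite big_split/= [X in _ - X](reindex_perm s)/=.
under [X in _ - X]eq_bigr do rewrite permK.
by rewrite addrK.
Qed.

(** * Dyadic mixing of two integers *)
Lemma sumr_pred {R : nzSemiRingType} {I : finType} (P : pred I) :
  \sum_i (P i)%:R = #|[set i | P i]%SET|%:R :> R.
Proof.
rewrite -sum1dep_card natr_sum [RHS]big_mkcond/=.
by apply: eq_bigr => i _; case: (P i).
Qed.

(** When b is uniform below 2 ^ L, this is uniform on the dyadic interval of
    length 2 ^ j containing a. *)
Definition mix (j a b : nat) : nat := a %/ 2 ^ j * 2 ^ j + b %% 2 ^ j.

Lemma mix0 a b : mix 0 a b = a.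
Proof. by rewrite /mix expn0 divn1 muln1 modn1 addn0. Qed.

Lemma mix_full L a b : (a < 2 ^ L)%N -> (b < 2 ^ L)%N -> mix L a b = b.
Proof. by move=> aL bL; rewrite /mix divn_small// mul0n add0n modn_small. Qed.

Lemma mix_lt L j a b : (j <= L)%N -> (a < 2 ^ L)%N -> (mix j a b < 2 ^ L)%N.
Proof.
move=> jL; rewrite -(subnK jL) expnD -ltn_divLR ?expn_gt0// /mix => qL.
have : (b %% 2 ^ j < 2 ^ j)%N by rewrite ltn_mod expn_gt0.
move: (2 ^ j)%N (a %/ _)%N (b %% _)%N (2 ^ (L - j))%N qL => M q r K; nia.
Qed.

(** Both numbers lie in the dyadic interval of length 2 ^ j.+1 containing a. *)
Lemma mix_step j a b :
  (mix j a b <= mix j.+1 a b + 2 ^ j.+1)%N /\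
  (mix j.+1 a b <= mix j a b + 2 ^ j.+1)%N.
Proof.
rewrite /mix expnSr divnMA.
have : (b %% 2 ^ j < 2 ^ j)%N by rewrite ltn_mod expn_gt0.
have : (b %% (2 ^ j * 2) < 2 ^ j * 2)%N by rewrite ltn_mod muln_gt0 expn_gt0.
move: (2 ^ j)%N (a %/ _)%N (b %% _)%N (b %% _)%N => M q r s.
have := divn_eq q 2; have : (q %% 2 < 2)%N by rewrite ltn_mod.
move: (q %/ 2)%N (q %% 2)%N => h e; nia.
Qed.

Lemma card_modn_eq L j r : (j <= L)%N ->
  (#|[set b : 'I_(2 ^ L) | b %% 2 ^ j == r :> nat]%SET| <= 2 ^ (L - j))%N.
Proof.
move=> jL.
have lt_div (b : 'I_(2 ^ L)) : (b %/ 2 ^ j < 2 ^ (L - j))%N.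
  by rewrite ltn_divLR ?expn_gt0// -expnD subnK.
rewrite -[leqRHS]card_ord.
rewrite -(@card_in_imset _ _ (fun b => Ordinal (lt_div b))) ?max_card//.
move=> b c; rewrite !inE => /eqP br /eqP cr /(congr1 val)/= bc.
by apply: val_inj; rewrite /= (divn_eq b (2 ^ j)) (divn_eq c (2 ^ j)) bc br cr.
Qed.

Lemma sum_mix_eq (R : realFieldType) L j a x : (j <= L)%N ->
  \sum_(b < 2 ^ L) (x == mix j a b)%:R <= (2 ^ L)%:R / (2 ^ j)%:R :> R.
Proof.
move=> jL; have -> : (2 ^ L)%:R / (2 ^ j)%:R = (2 ^ (L - j))%:R :> R.
  by rewrite -{1}(subnK jL) expnD natrM mulfK// pnatr_eq0 -lt0n expn_gt0.
rewrite sumr_pred ler_nat.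
apply: leq_trans (card_modn_eq (x - a %/ 2 ^ j * 2 ^ j) jL).
apply: subset_leq_card; apply/fintype.subsetP => b; rewrite !inE => /eqP->.
by rewrite /mix addKn.
Qed.

Lemma sum_ltn (R : realFieldType) M x : (x <= M)%N ->
  \sum_(m < M) (m < x)%:R = x%:R :> R.
Proof.
move=> xM; rewrite sumr_pred; congr _%:R.
have winj : injective (widen_ord xM) by move=> k l /(congr1 val)/= /val_inj.
rewrite -[RHS]card_ord -(card_imset _ winj).
apply: eq_card => m; rewrite inE; apply/idP/imsetP => [mx|[k _ ->]//=].
by exists (Ordinal mx) => //; apply: val_inj.
Qed.

(** The sum counts the unit steps between x and y. *)
Lemma sum_abs_ltn (R : realFieldType) M x y D :
  (x <= M)%N -> (y <= M)%N -> (x <= y + D)%N -> (y <= x + D)%N ->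
  \sum_(m < M) `|(m < x)%:R - (m < y)%:R| <= D%:R :> R.
Proof.
wlog xy : x y / (x <= y)%N.
  move=> hw xM yM xyD yxD; have [xy|/ltnW yx] := leqP x y; first exact: hw.
  by under eq_bigr do rewrite distrC; exact: hw.
move=> xM yM _ yxD.
under eq_bigr => m _.
  rewrite ler0_norm ?opprB; last first.
    rewrite subr_le0 ler_nat; case: (ltnP m x) => // mx.
    by rewrite (leq_trans mx xy).
  over.
by rewrite sumrB !sum_ltn// lerBlDl -natrD ler_nat.
Qed.

(** In the square of a sum, each product is charged to its term of larger index;
    the partial sums can then be bounded separately from the last term. *)
Lemma sqr_sum_le {R : realDomainType} (b : nat -> R) n : (forall j, 0 <= b j) ->
  (\sum_(j < n) b j) ^+ 2 <= 2 * \sum_(k < n) b k * \sum_(j < k.+1) b j.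
Proof.
move=> b0; elim: n => [|n IH]; first by rewrite !big_ord0 expr0n mulr0.
rewrite !(big_ord_recr n)/=.
have := sqr_ge0 (b n); move: IH.
move: (\sum_(k < n) (b k * \sum_(j < k.+1) b j)) (\sum_(i < n) b i) (b n).
by move=> Q S x; rewrite !expr2 => ? ?; nra.
Qed.

(** * Flows on the dyadic grid *)
Section grid_flow.
Context {R : realFieldType} (d L : nat).

Definition grid := {ffun 'I_d -> 'I_(2 ^ L)}.

Definition grid_point (p : grid) : 'I_d -> nat := fun k => p k.

Definition set_coord (q : 'I_d -> nat) (i : 'I_d) (m : nat) : 'I_d -> nat :=
  fun k => if k == i then m else q k.

Definition same_line (i : 'I_d) (q : 'I_d -> nat) (p : grid) : bool :=
  [forall k, (k != i) ==> (p k == q k :> nat)].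

(** As u ranges over the grid, [waypoint j 0 z u] is uniform on the dyadic cube
    of side 2 ^ j around z, and the waypoints [waypoint j i z u], for i from 0
    to d, pass from this cube to the cube of side 2 ^ j.+1 by changing one
    coordinate at a time. *)
Definition waypoint (j i : nat) (z u : grid) : 'I_d -> nat :=
  fun k => mix (j + (k < i)) (z k) (u k).

(** The signed number of passages over the edge between m and m.+1 on the way
    from [mix j.+1 a b] to [mix j a b]. *)
Definition crossing (j a b m : nat) : R :=
  (m < mix j a b)%:R - (m < mix j.+1 a b)%:R.

(** The edge from p in direction i is used by the i-th move of the path of u
    only if p agrees with the waypoint in the other coordinates. *)
Definition scale_flow (j : nat) (z : grid) (i : 'I_d) (p : grid) : R :=
  #|grid|%:R^-1 *
  \sum_(u : grid) (same_line i (waypoint j i z u) p)%:R * crossing j (z i) (u i) (p i).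

Definition flow (z : grid) (i : 'I_d) (p : grid) : R :=
  \sum_(j < L) scale_flow j z i p.

Definition increment (f : ('I_d -> nat) -> R) (i : 'I_d) (p : grid) : R :=
  f (set_coord (grid_point p) i (p i).+1) - f (grid_point p).

Lemma card_grid : #|grid| = ((2 ^ L) ^ d)%N.
Proof. by rewrite card_ffun !card_ord. Qed.

Lemma waypoint_lt j i z u k : (j < L)%N -> (waypoint j i z u k < 2 ^ L)%N.
Proof. by move=> jL; apply: mix_lt => //; case: (k < i)%N; rewrite ?addn1 ?addn0// ltnW. Qed.

Lemma sum_same_line (i : 'I_d) (q : 'I_d -> nat) (F : ('I_d -> nat) -> R) :
  (forall k, (q k < 2 ^ L)%N) ->
  \sum_(p : grid) (same_line i q p)%:R * F (grid_point p) =
  \sum_(m < 2 ^ L) F (set_coord q i m).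
Proof.
move=> qL; rewrite (bigID (same_line i q))/= [X in _ + X]big1 ?addr0; last first.
  by move=> p /negbTE->; rewrite mul0r.
pose q' (m : 'I_(2 ^ L)) : grid :=
  [ffun k => if k == i then m else Ordinal (qL k)].
rewrite (reindex_onto q' (fun p => p i)); last first.
  move=> p /forallP pq; apply/ffunP => k; rewrite ffunE; case: eqVneq => [->//|ki].
  by apply: val_inj => /=; apply/esym/eqP; have /implyP := pq k; apply.
have q'q m : same_line i q (q' m).
  by apply/forallP => k; apply/implyP => ki; rewrite ffunE (negbTE ki).
apply: eq_big => [m|m _]; first by rewrite q'q ffunE !eqxx.
rewrite q'q mul1r; congr F; apply/funext => k.
by rewrite /grid_point /set_coord ffunE; case: ifP.
Qed.

Lemma line_telescope (f : ('I_d -> nat) -> R) (i : 'I_d) (q : 'I_d -> nat) a b :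
  (a <= 2 ^ L)%N -> (b <= 2 ^ L)%N ->
  f (set_coord q i a) - f (set_coord q i b) =
  \sum_(m < 2 ^ L) (f (set_coord q i m.+1) - f (set_coord q i m)) *
     ((m < a)%:R - (m < b)%:R).
Proof.
move=> aL bL; under eq_bigr do rewrite mulrBr.
rewrite sumrB.
have H c : (c <= 2 ^ L)%N -> \sum_(m < 2 ^ L)
    (f (set_coord q i m.+1) - f (set_coord q i m)) * (m < c)%:R =
    f (set_coord q i c) - f (set_coord q i 0).
  move=> cL; rewrite -(telescope_sumr (fun m => f (set_coord q i m)) (leq0n c)).
  rewrite big_mkord (big_ord_widen _ (fun m => f (set_coord q i m.+1) - f (set_coord q i m)) cL).
  by rewrite [RHS]big_mkcond; apply: eq_bigr => m _; case: ifP; rewrite ?mulr1 ?mulr0.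
by rewrite !H//; ring.
Qed.

(** Summation by parts: the flow of z transports the point mass at z to the
    uniform distribution.  Along the waypoints of each u the differences of f
    telescope, first over the scales and coordinates and then over the unit
    edges of each move. *)
Lemma flow_divergence (f : ('I_d -> nat) -> R) (z : grid) :
  f (grid_point z) - #|grid|%:R^-1 * \sum_(u : grid) f (grid_point u) =
  \sum_i \sum_p increment f i p * flow z i p.
Proof.
have card_neq0 : #|grid|%:R != 0 :> R.
  by rewrite card_grid pnatr_eq0 -lt0n !expn_gt0.
have step u : f (grid_point z) - f (grid_point u) =
    \sum_i \sum_(p : grid) increment f i p * \sum_(j < L)
      (same_line i (waypoint j i z u) p)%:R * crossing j (z i) (u i) (p i).
  transitivity (\sum_(j < L) \sum_(i < d)
      (f (waypoint j i z u) - f (waypoint j i.+1 z u))).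
    have next_scale j : waypoint j d z u = waypoint j.+1 0 z u.
      by apply/funext => k; rewrite /waypoint ltn_ord ltn0 addn1 addn0.
    have tele j : \sum_(i < d) (f (waypoint j i z u) - f (waypoint j i.+1 z u)) =
        f (waypoint j 0 z u) - f (waypoint j.+1 0 z u).
      rewrite -next_scale -[RHS]opprB -(telescope_sumr (fun i => f (waypoint j i z u)) (leq0n d)).
      by rewrite big_mkord -sumrN; apply: eq_bigr => i _; rewrite opprB.
    under eq_bigr do rewrite tele.
    have -> : f (grid_point z) = f (waypoint 0 0 z u).
      by congr f; apply/funext => k; rewrite /waypoint mix0.
    have -> : f (grid_point u) = f (waypoint L 0 z u).
      by congr f; apply/funext => k; rewrite /waypoint addn0 mix_full.
    rewrite -[LHS]opprB -(telescope_sumr (fun i => f (waypoint i 0 z u)) (leq0n L)).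
    by rewrite big_mkord -sumrN; apply: eq_bigr => i _; rewrite opprB.
  rewrite exchange_big/=; apply: eq_bigr => i _.
  under [RHS]eq_bigr do rewrite big_distrr/=.
  rewrite [RHS]exchange_big/=; apply: eq_bigr => j _.
  pose q := waypoint j i z u.
  transitivity (f (set_coord q i (mix j (z i) (u i))) -
                f (set_coord q i (mix j.+1 (z i) (u i)))).
    congr (f _ - f _); apply/funext => k; rewrite /set_coord /q /waypoint.
      by case: eqVneq => [->|//]; rewrite ltnn addn0.
    case: eqVneq => [->|ki]; first by rewrite ltnSn addn1.
    by rewrite ltnS leq_eqVlt -(inj_eq val_inj) in ki *; rewrite (negbTE ki).
  rewrite line_telescope; try (by apply/ltnW/mix_lt => //; exact: ltnW).
  pose F p := (f (set_coord p i (p i).+1) - f p)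
    * ((p i < mix j (z i) (u i))%:R - (p i < mix j.+1 (z i) (u i))%:R).
  transitivity (\sum_(m < 2 ^ L) F (set_coord q i m)).
    apply: eq_bigr => m _; rewrite /F.
    have -> : set_coord q i m i = m by rewrite /set_coord eqxx.
    congr ((f _ - _) * _); apply/funext => k; rewrite /set_coord.
    by case: ifP.
  rewrite -sum_same_line; last by move=> k; exact: waypoint_lt.
  by apply: eq_bigr => p _; rewrite [RHS]mulrCA.
transitivity (#|grid|%:R^-1 * \sum_(u : grid) (f (grid_point z) - f (grid_point u))).
  have sum_cst (c : R) : \sum_(u : grid) c = #|grid|%:R * c.
    by rewrite sumr_const mulr_natl.
  by rewrite sumrB sum_cst mulrBr mulKf.
under eq_bigr do rewrite step.
rewrite exchange_big/= mulr_sumr; apply: eq_bigr => i _.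
rewrite exchange_big/= mulr_sumr; apply: eq_bigr => p _.
rewrite -mulr_sumr mulrCA; congr (_ * _).
by rewrite exchange_big/= mulr_sumr.
Qed.

(** Bounds the absolute value of [scale_flow]; unlike it, it is a sum of
    nonnegative terms, and can be summed over p exactly. *)
Definition usage (j : nat) (z : grid) (i : 'I_d) (p : grid) : R :=
  #|grid|%:R^-1 *
  \sum_(u : grid) (same_line i (waypoint j i z u) p)%:R * `|crossing j (z i) (u i) (p i)|.

Lemma usage_ge0 j z i p : 0 <= usage j z i p.
Proof. by rewrite mulr_ge0 ?invr_ge0//; apply: sumr_ge0 => u _; rewrite mulr_ge0. Qed.

Lemma norm_scale_flow j z i p : `|scale_flow j z i p| <= usage j z i p.
Proof.
rewrite /scale_flow normrM ger0_norm ?invr_ge0// ler_wpM2l ?invr_ge0//.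
apply: le_trans (ler_norm_sum _ _ _) _; apply: ler_sum => u _.
by rewrite normrM ger0_norm.
Qed.

Lemma card_grid_gt0 : 0 < #|grid|%:R :> R.
Proof. by rewrite card_grid ltr0n !expn_gt0. Qed.

(** Each path makes, in direction i and at scale j, a single move of length at
    most 2 ^ j.+1. *)
Lemma sum_usage j z i : (j < L)%N ->
  \sum_(p : grid) usage j z i p <= (2 ^ j.+1)%:R.
Proof.
move=> jL; rewrite -mulr_sumr exchange_big/= ler_pdivrMl ?card_grid_gt0//.
rewrite mulr_natl -sumr_const; apply: ler_sum => u _.
rewrite (sum_same_line i (fun q => `|crossing j (z i) (u i) (q i)|)); last first.
  by move=> k; exact: waypoint_lt.
under eq_bigr do rewrite /set_coord eqxx.
have [? ?] := mix_step j (z i) (u i).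
by apply: sum_abs_ltn => //; apply/ltnW/mix_lt => //; exact: ltnW.
Qed.

Lemma norm_crossing j a b m : `|crossing j a b m| <= 1.
Proof.
rewrite /crossing; do 2 case: (_ < _)%N => /=;
by rewrite ?subrr ?subr0 ?sub0r ?normrN ?normr1 ?normr0.
Qed.

(** A path can use the edge only if d.-1 of its coordinates, uniform on intervals
    of length at least 2 ^ j and independent, take prescribed values. *)
Lemma usage_le j z i p : (j < L)%N -> usage j z i p <= (2 ^ j)%:R ^- d.-1.
Proof.
move=> jL; rewrite /usage ler_pdivrMl ?card_grid_gt0//.
pose c (k : 'I_d) (b : 'I_(2 ^ L)) : R :=
  if k == i then 1 else (p k == mix (j + (k < i)) (z k) b :> nat)%:R.
apply: (@le_trans _ _ (\sum_(u : grid) \prod_k c k (u k))).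
  apply: ler_sum => u _; apply: le_trans (ler_piMr _ (norm_crossing _ _ _ _)) _ => //.
  have [/forallP ul|_] := boolP (same_line _ _ _); last first.
    by apply: prodr_ge0 => k _; rewrite /c; case: ifP.
  rewrite big1// => k _; rewrite /c; case: eqVneq => // ki.
  by have /implyP/(_ ki) := ul k; rewrite /waypoint => ->.
(* The coordinates of u are independent: the sum over u factorizes. *)
rewrite -(bigA_distr_bigA c).
apply: (@le_trans _ _ (\prod_(k < d) ((2 ^ L)%:R * (if k == i then 1 else (2 ^ j)%:R^-1)))).
  apply: ler_prod => k _; apply/andP; split.
    by apply: sumr_ge0 => b _; rewrite /c; case: ifP.
  rewrite /c; case: ifP => ki; first by rewrite sumr_const card_ord mulr1.
  have [jk|jk] := boolP (k < i)%N.
    rewrite addn1; apply: le_trans (sum_mix_eq _ _ _ _) _ => //.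
    by rewrite ler_wpM2l// lef_pV2 ?posrE ?ltr0n ?expn_gt0// ler_nat leq_exp2l.
  by rewrite addn0; apply: sum_mix_eq; exact: ltnW.
rewrite big_split/= prodr_const card_ord card_grid (natrX _ (2 ^ L) d) ler_wpM2l ?exprn_ge0//.
rewrite (bigD1 i)//= eqxx mul1r (eq_bigr (fun=> (2 ^ j)%:R^-1)); last first.
  by move=> k /negbTE->.
by rewrite prodr_const cardC1 card_ord exprVn.
Qed.

(** For scales j <= k, the products are summed over p by taking out the maximum
    of the coarser scale k, at most 2 ^ (- k (d - 1)), and summing the finer
    one, at most 2 ^ j.+1; the sum over j of the latter is of order 2 ^ k. *)
Lemma flow_energy (z : grid) :
  \sum_i \sum_p flow z i p ^+ 2 <=
    8 * d%:R * \sum_(j < L) (2 ^ j)%:R / (2 ^ j)%:R ^+ d.-1.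
Proof.
suff H i : \sum_p flow z i p ^+ 2 <= 8 * \sum_(j < L) (2 ^ j)%:R / (2 ^ j)%:R ^+ d.-1.
  apply: le_trans (ler_sum _ (fun i _ => H i)) _.
  by rewrite sumr_const card_ord -[leLHS]mulr_natl mulrCA mulrA.
apply: (@le_trans _ _ (\sum_p 2 * \sum_(k < L) usage k z i p * \sum_(j < k.+1) usage j z i p)).
  apply: ler_sum => p _.
  apply: le_trans (sqr_sum_le L (fun j => usage_ge0 j z i p)).
  rewrite -real_normK ?num_real// ler_sqr ?nnegrE//; last first.
    by apply: sumr_ge0 => j _; exact: usage_ge0.
  apply: le_trans (ler_norm_sum _ _ _) _.
  by apply: ler_sum => j _; exact: norm_scale_flow.
rewrite -mulr_sumr exchange_big/= (_ : 8 = 2 * 4 :> R) -?mulrA; last by rewrite -natrM.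
rewrite ler_wpM2l// mulr_sumr; apply: ler_sum => k _.
apply: (@le_trans _ _ (\sum_p (2 ^ k)%:R ^- d.-1 * \sum_(j < k.+1) usage j z i p)).
  apply: ler_sum => p _; rewrite ler_wpM2r ?usage_le//.
  by apply: sumr_ge0 => j _; exact: usage_ge0.
rewrite -mulr_sumr mulrA [leRHS]mulrC ler_wpM2l ?invr_ge0 ?exprn_ge0//.
rewrite exchange_big/=.
apply: (@le_trans _ _ (\sum_(j < k.+1) (2 ^ j.+1)%:R)).
  by apply: ler_sum => j _; apply: sum_usage; apply: leq_trans (ltn_ord k).
rewrite -natr_sum -natrM ler_nat.
have -> n : (\sum_(j < n) 2 ^ j.+1)%N = (2 ^ n.+1 - 2)%N.
  elim: n => [|n IH]; first by rewrite big_ord0.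
  rewrite big_ord_recr/= IH [in RHS]expnS mul2n -addnn addnBAC//.
  by rewrite -{1}(expn1 2) leq_exp2l.
by rewrite !expnS; lia.
Qed.
End grid_flow.

(** * Transport cost of empirical measures *)

(** The bounds for the Euclidean cost go through the larger cost l1, for which
    the triangle inequality and the length of a grid edge are immediate. *)
Definition l1_dist {R : realType} {d : nat} (a b : d.-tuple R) : R :=
  \sum_(i < d) `|tnth a i - tnth b i|.

Lemma l1_dist_triangle {R : realType} {d : nat} (a b c : d.-tuple R) :
  l1_dist a c <= l1_dist a b + l1_dist b c.
Proof.
by rewrite /l1_dist -big_split; apply: ler_sum => i _; exact: ler_distD.
Qed.

Lemma l1_distC {R : realType} {d : nat} (a b : d.-tuple R) :
  l1_dist a b = l1_dist b a.
Proof. by apply: eq_bigr => i _; rewrite distrC. Qed.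

Lemma l1_distxx {R : realType} {d : nat} (a : d.-tuple R) : l1_dist a a = 0.
Proof. by rewrite /l1_dist big1// => i _; rewrite subrr normr0. Qed.

Lemma eucl_le_l1 {R : realType} {d : nat} (a b : d.-tuple R) :
  eucl_dist a b <= l1_dist a b.
Proof.
have l1_ge0 : 0 <= l1_dist a b by apply: sumr_ge0.
rewrite /eucl_dist -[leRHS](ger0_norm l1_ge0) -sqrtr_sqr ler_wsqrtr//.
rewrite /l1_dist expr2 mulr_suml; apply: ler_sum => i _.
rewrite -real_normK ?num_real// expr2 ler_wpM2l//.
by rewrite (bigD1 i)//= lerDl sumr_ge0.
Qed.

Lemma measurable_eucl_dist (R : realType) (d : nat) :
  measurable_fun setT
    (fun z : d.-tuple R * d.-tuple R => eucl_dist z.1 z.2).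
Proof.
apply: measurableT_comp.
  by apply: continuous_measurable_fun; exact: sqrt_continuous.
apply: measurable_sum => i; apply: measurable_funX; apply: measurable_funB.
  by apply: (measurableT_comp (measurable_tnth i)); exact: measurable_fst.
by apply: (measurableT_comp (measurable_tnth i)); exact: measurable_snd.
Qed.

Lemma integral_empirical (R : realType) (disp : measure_display)
    (V : measurableType disp) (n : nat) (n_gt0 : (0 < n)%N) (x : 'I_n -> V)
    (f : V -> R) : measurable_fun setT f -> (forall v, 0 <= f v) ->
  (\int[empirical n_gt0 x]_v (f v)%:E =
   (n%:R^-1 * \sum_(k < n) f (x k))%:E)%E.
Proof.
move=> /measurable_EFinP mf f0; rewrite EFinM -sumEFin.
have c_ge0 : (0 <= n%:R^-1 :> R)%R by rewrite invr_ge0.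
pose m (k : nat) : {measure set V -> \bar R} :=
  [the measure V R of \d_(x (odflt (Ordinal n_gt0) (insub k)))].
rewrite (eq_measure_integral (mscale (NngNum c_ge0) (msum m n))); last first.
  move=> A _ _; rewrite /empirical /mscale /msum/=; congr (_ * _)%E.
  by apply: eq_bigr => k _; rewrite /m /= valK.
rewrite ge0_integral_mscale//; last by move=> v _; rewrite lee_fin.
congr (_ * _)%E.
rewrite (@ge0_integral_measure_sum _ V R m setT measurableT (EFin \o f) _ mf n).
  by apply: eq_bigr => k _; rewrite integral_dirac// diracT mul1e /= valK.
by move=> v _; rewrite lee_fin.
Qed.

(** The empirical measure of the matched pairs is a coupling. *)
Lemma W1_le_matching (R : realType) (d n : nat) (n_gt0 : (0 < n)%N)
    (x y : 'I_n -> d.-tuple R) (s : {perm 'I_n}) :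
  (W1 (empirical n_gt0 x) (empirical n_gt0 y) <=
   (n%:R^-1 * \sum_k eucl_dist (x k) (y (s k)))%:E)%E.
Proof.
pose z k := (x k, y (s k)).
apply: ereal_inf_lbound; exists (empirical n_gt0 z).
  split=> A mA /=; rewrite /empirical; congr (_ * _)%E.
    by apply: eq_bigr => k _; rewrite /dirac/= !indicE in_setX/= in_setT andbT.
  rewrite [RHS](reindex_perm s)/=; apply: eq_bigr => k _.
  by rewrite /dirac/= !indicE in_setX/= in_setT.
rewrite integral_empirical; first by [].
  exact: measurable_eucl_dist.
by move=> v; exact: sqrtr_ge0.
Qed.

(** The dual variables of the optimal assignment extend to a Lipschitz function
    on the whole space, the lower envelope of the cones v j + l1_dist a (y j). *)
Lemma W1_le_potential (R : realType) (d n : nat) (n_gt0 : (0 < n)%N)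
    (x y : 'I_n -> d.-tuple R) :
  exists2 F : d.-tuple R -> R, (forall a b, `|F a - F b| <= l1_dist a b) &
  (W1 (empirical n_gt0 x) (empirical n_gt0 y) <=
   (n%:R^-1 * \sum_k (F (x k) - F (y k)))%:E)%E.
Proof.
have [s [u [v [uv suv]]]] := assignment_duality (fun i j => l1_dist (x i) (y j)).
pose best a := [arg min_(j < Ordinal n_gt0) (v j + l1_dist a (y j))]%O.
pose F a := v (best a) + l1_dist a (y (best a)).
have F_le a j : F a <= v j + l1_dist a (y j).
  by rewrite /F /best; case: arg_minP => // k _; apply.
exists F.
  move=> a b; wlog suff H : a b / F a - F b <= l1_dist a b.
    by rewrite ler_norml H andbT lerNl opprB l1_distC.
  rewrite lerBlDr (le_trans (F_le a (best b)))// /F addrCA lerD2l.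
  exact: l1_dist_triangle.
apply: le_trans (W1_le_matching n_gt0 x y s) _.
rewrite lee_fin ler_wpM2l ?invr_ge0//.
apply: (@le_trans _ _ (\sum_i l1_dist (x i) (y (s i)))).
  by apply: ler_sum => i _; exact: eucl_le_l1.
rewrite suv sumrB lerB//; apply: ler_sum => i _.
  by rewrite /F -lerBlDl uv.
by rewrite (le_trans (F_le _ i))// l1_distxx addr0.
Qed.

(** * Means of finitely valued random variables *)
Section finite_valued.
Context {R : realType} {disp : measure_display} {T : measurableType disp}.
Context (P : probability T R) {A : finType} (D : T -> A).

(** The expectation of phi(D) as a finite sum, so that signed phi raise no
    question of integrability. *)
Definition fin_mean (phi : A -> R) : R :=
  \sum_a phi a * fine (P (D @^-1` [set a])).

Lemma ler_fin_mean (phi psi : A -> R) : (forall a, phi a <= psi a) ->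
  fin_mean phi <= fin_mean psi.
Proof. by move=> h; apply: ler_sum => a _; rewrite ler_wpM2r ?fine_ge0. Qed.

Lemma fin_mean_sum (I : finType) (phi : I -> A -> R) :
  fin_mean (fun a => \sum_i phi i a) = \sum_i fin_mean (phi i).
Proof.
by rewrite /fin_mean exchange_big/=; apply: eq_bigr => a _; rewrite mulr_suml.
Qed.

Lemma fin_meanD (phi psi : A -> R) :
  fin_mean (fun a => phi a + psi a) = fin_mean phi + fin_mean psi.
Proof. by rewrite /fin_mean -big_split/=; apply: eq_bigr => a _; rewrite mulrDl. Qed.

Lemma fin_meanZ (c : R) (phi : A -> R) :
  fin_mean (fun a => c * phi a) = c * fin_mean phi.
Proof. by rewrite /fin_mean mulr_sumr; apply: eq_bigr => a _; rewrite mulrA. Qed.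

Hypothesis mD : forall a, measurable (D @^-1` [set a]).

Lemma integral_fin_mean (phi : A -> R) : (forall a, 0 <= phi a) ->
  (\int[P]_w (phi (D w))%:E = (fin_mean phi)%:E)%E.
Proof.
move=> phi0.
have -> : (fun w => (phi (D w))%:E) =
    (fun w => \sum_a (phi a)%:E * (\1_(D @^-1` [set a]) w)%:E)%E.
  apply/funext => w; rewrite (bigD1 (D w))//= big1 ?adde0; last first.
    move=> a /eqP aD; rewrite indicE memNset ?mule0// => /= Dwa.
    exact/aD/esym.
  by rewrite indicE mem_set//= mule1.
rewrite ge0_integral_sum//; last 2 first.
  move=> a; apply/measurable_EFinP; apply: measurable_funM => //.
    by move=> a w _; rewrite -EFinM lee_fin mulr_ge0.
rewrite /fin_mean -sumEFin; apply: eq_bigr => a _.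
rewrite ge0_integralZl//; last 2 first.
  by apply/measurable_EFinP.
  by rewrite lee_fin.
by rewrite integral_indic// setIT EFinM fineK// fin_num_measure.
Qed.

Lemma fin_mean_event (Q : pred A) : measurable [set w | Q (D w)] ->
  fin_mean (fun a => (Q a)%:R) = fine (P [set w | Q (D w)]).
Proof.
move=> mQ; have /(congr1 fine) /= <- := @integral_fin_mean (fun a => (Q a)%:R) (fun a => ler0n _ _).
rewrite -[X in fine (P X)]setIT -integral_indic//; congr fine.
apply: eq_integral => w _; rewrite indicE.
by case: (boolP (Q (D w))) => QD; [rewrite mem_set|rewrite memNset//; exact/negP].
Qed.

Lemma fin_mean_cst (c : R) : fin_mean (fun=> c) = c.
Proof.
have -> : (fun _ : A => c) = (fun a => c * (xpredT a)%:R) by apply/funext => a; rewrite mulr1.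
rewrite fin_meanZ fin_mean_event//=.
  have -> : [set _ : T | true] = setT by apply/seteqP.
  by rewrite probability_setT mulr1.
have -> : [set _ : T | true] = setT by apply/seteqP.
exact: measurableT.
Qed.

End finite_valued.

(** Second moments of sums over pairwise independent couples: D w k is the pair
    of values of the k-th couple. *)
Section second_moment.
Context {R : realType} {disp : measure_display} {T : measurableType disp}.
Context (P : probability T R) {B : finType} (n : nat).
Context (D : T -> {ffun 'I_n -> B * B}).
Hypothesis mD : forall k b, measurable [set w | D w k = b].
Hypothesis indepD : forall j k b c, j != k ->
  (P [set w | D w j = b /\ D w k = c] = P [set w | D w j = b] * P [set w | D w k = c])%E.
Hypothesis same_law : forall k z,
  P [set w | (D w k).1 = z] = P [set w | (D w k).2 = z].

Local Notation mean := (fin_mean P D).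

Lemma measurable_joint a : measurable (D @^-1` [set a]).
Proof.
have -> : D @^-1` [set a] = \bigcap_(k in setT) [set w | D w k = a k].
  apply/seteqP; split => w /=; first by move=> Dwa k _ /=; rewrite Dwa.
  by move=> Da; apply/ffunP => k; exact: Da.
apply: fin_bigcap_measurable => //; exact: finite_finset.
Qed.

Lemma measurable_finite_event (k : 'I_n) (Q : pred (B * B)) :
  measurable [set w | Q (D w k)].
Proof.
have -> : [set w | Q (D w k)] = \bigcup_(b in [set b | Q b]) [set w | D w k = b].
  by apply/seteqP; split => [w/= Qw|w [b /= Qb ->]//]; exists (D w k).
apply: fin_bigcup_measurable => //; exact: finite_finset.
Qed.

Lemma mean_marginal k (phi : B * B -> R) :
  mean (fun a => phi (a k)) = \sum_b phi b * fine (P [set w | D w k = b]).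
Proof.
have -> : (fun a : {ffun 'I_n -> B * B} => phi (a k)) = (fun a => \sum_b phi b * (a k == b)%:R).
  apply/funext => a; rewrite (bigD1 (a k))//= eqxx mulr1 big1 ?addr0// => b.
  by rewrite eq_sym => /negbTE->; rewrite mulr0.
rewrite fin_mean_sum; apply: eq_bigr => b _; rewrite fin_meanZ.
have eqb : [set w | D w k == b] = [set w | D w k = b].
  by apply/seteqP; split => w /eqP.
rewrite (fin_mean_event P measurable_joint (Q := fun a => a k == b)) ?eqb//.
Qed.

Lemma mean_independent j k (phi psi : B * B -> R) : j != k ->
  mean (fun a => phi (a j) * psi (a k)) =
  mean (fun a => phi (a j)) * mean (fun a => psi (a k)).
Proof.
move=> jk; rewrite !mean_marginal.
have -> : (fun a : {ffun 'I_n -> B * B} => phi (a j) * psi (a k)) =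
    (fun a => \sum_b \sum_c phi b * psi c * ((a j == b) && (a k == c))%:R).
  apply/funext => a; rewrite (bigD1 (a j))//= [X in _ = _ + X]big1 ?addr0.
    rewrite (bigD1 (a k))//= !eqxx mulr1 [X in _ = _ + X]big1 ?addr0// => c.
    by rewrite eq_sym => /negbTE->; rewrite mulr0.
  by move=> b; rewrite eq_sym => /negbTE->; rewrite big1// => c _; rewrite mulr0.
rewrite fin_mean_sum mulr_suml; apply: eq_bigr => b _.
rewrite fin_mean_sum mulr_sumr; apply: eq_bigr => c _; rewrite fin_meanZ.
have eqbc : [set w | (D w j == b) && (D w k == c)] = [set w | D w j = b /\ D w k = c].
  by apply/seteqP; split => w; [move=> /andP[/eqP ? /eqP ?]|move=> [/= -> ->]; rewrite !eqxx].
rewrite (fin_mean_event P measurable_joint (Q := fun a => (a j == b) && (a k == c))) eqbc; last first.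
  exact: measurableI (mD j b) (mD k c).
by rewrite indepD// fineM ?fin_num_measure// mulrACA.
Qed.

Lemma mean_fst_snd k (h : B -> R) :
  mean (fun a => h (a k).1) = mean (fun a => h (a k).2).
Proof.
have H (g : B * B -> B) : mean (fun a => h (g (a k))) =
    \sum_z h z * fine (P [set w | g (D w k) = z]).
  have -> : (fun a : {ffun 'I_n -> B * B} => h (g (a k))) = (fun a => \sum_z h z * (g (a k) == z)%:R).
    apply/funext => a; rewrite (bigD1 (g (a k)))//= eqxx mulr1 big1 ?addr0// => b.
    by rewrite eq_sym => /negbTE->; rewrite mulr0.
  rewrite fin_mean_sum; apply: eq_bigr => z _; rewrite fin_meanZ.
  have eqb : [set w | g (D w k) == z] = [set w | g (D w k) = z].
    by apply/seteqP; split => w /eqP.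
  rewrite (fin_mean_event P measurable_joint (Q := fun a => g (a k) == z)) ?eqb//.
  rewrite -eqb; exact: (measurable_finite_event k (fun b => g b == z)).
rewrite (H fst) (H snd); apply: eq_bigr => z _.
by rewrite same_law.
Qed.

(** The terms have mean zero by equality of laws, so pairwise independence
    cancels all cross terms. *)
Lemma mean_sqr_sum (h : B -> R) :
  mean (fun a => (\sum_k (h (a k).1 - h (a k).2)) ^+ 2) =
  \sum_k mean (fun a => (h (a k).1 - h (a k).2) ^+ 2).
Proof.
pose U (b : B * B) := h b.1 - h b.2.
have -> : (fun a : {ffun 'I_n -> B * B} => (\sum_k (h (a k).1 - h (a k).2)) ^+ 2) =
    (fun a => \sum_j \sum_k U (a j) * U (a k)).
  apply/funext => a; rewrite expr2 mulr_suml; apply: eq_bigr => j _.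
  by rewrite mulr_sumr.
rewrite fin_mean_sum; apply: eq_bigr => j _.
rewrite fin_mean_sum (bigD1 j)//= big1 ?addr0//.
move=> k kj; rewrite mean_independent 1?eq_sym//.
have -> : mean (fun a => U (a k)) = 0; last by rewrite mulr0.
have -> : (fun a : {ffun 'I_n -> B * B} => U (a k)) = (fun a => h (a k).1 + (-1) * h (a k).2).
  by apply/funext => a; rewrite mulN1r.
by rewrite fin_meanD fin_meanZ mean_fst_snd mulN1r subrr.
Qed.

End second_moment.

(** The integral of a nonnegative function is the supremum of the integrals of
    the simple functions below it; monotonicity thus holds for functions that
    are not known to be measurable, such as w |-> W1 of random empirical
    measures. *)
Lemma le_integral_pointwise {d} {T : measurableType d} {R : realType}
    (mu : {measure set T -> \bar R}) (f g : T -> \bar R) :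
  (forall x, 0 <= f x)%E -> (forall x, f x <= g x)%E ->
  (\int[mu]_x f x <= \int[mu]_x g x)%E.
Proof.
move=> f0 fg; rewrite !ge0_integralTE//; last first.
  by move=> x; exact: le_trans (fg x).
apply: ge_ereal_sup => _ [h /= hf <-]; apply: ereal_sup_ubound => /=.
by exists h => //= x; exact: le_trans (hf x) (fg x).
Qed.

(** * Rounding to the grid *)
Lemma cell_lt {R : realType} (L : nat) (r : R) :
  (minn (Num.truncn ((2 ^ L)%:R * r)) (2 ^ L).-1 < 2 ^ L)%N.
Proof. by rewrite gtn_min ltn_predL expn_gt0 orbT. Qed.

(** The truncation at 2 ^ L - 1 only serves to put the endpoint 1 in the last
    cell. *)
Definition cell {R : realType} (L : nat) (r : R) : 'I_(2 ^ L) :=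
  Ordinal (cell_lt L r).

Lemma dist_cell {R : realType} (L : nat) (r : R) : 0 <= r <= 1 ->
  `|r - (cell L r)%:R / (2 ^ L)%:R| <= (2 ^ L)%:R^-1.
Proof.
move=> /andP[r0 r1]; rewrite /cell /=.
have N0 : 0 < (2 ^ L)%:R :> R by rewrite ltr0n expn_gt0.
have /andP[tr rt] := truncn_itv (mulr_ge0 (ltW N0) r0).
set t := Num.truncn _ in tr rt *.
have NE : (2 ^ L)%:R = (2 ^ L).-1%:R + 1 :> R.
  by rewrite natr1 prednK// expn_gt0.
have -> : r - (minn t (2 ^ L).-1)%:R / (2 ^ L)%:R =
    ((2 ^ L)%:R * r - (minn t (2 ^ L).-1)%:R) / (2 ^ L)%:R.
  by rewrite mulrBl mulrAC divff ?mul1r// gt_eqF.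
rewrite normrM (ger0_norm (_ : 0 <= (2 ^ L)%:R^-1)) ?invr_ge0//.
rewrite ler_piMl ?invr_ge0//.
have Nr : (2 ^ L)%:R * r <= (2 ^ L)%:R by rewrite ler_piMr// ltW.
have [tN|tN] := leqP t (2 ^ L).-1.
  by rewrite ler_norml -natr1 in rt *; lra.
have : (2 ^ L).-1.+1%:R <= t%:R :> R by rewrite ler_nat.
rewrite -natr1 ler_norml => ?; lra.
Qed.

Lemma le_cell {R : realType} (L : nat) (r s : R) :
  r <= s -> (cell L r <= cell L s)%N.
Proof.
move=> rs; rewrite /= leq_min !geq_min leqnn orbT andbT.
by rewrite le_truncn// ler_wpM2l.
Qed.

(** Rounding is monotone, so its fibres are intervals. *)
Lemma measurable_cell {R : realType} (L : nat) (m : 'I_(2 ^ L)) :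
  measurable [set r : R | cell L r = m].
Proof.
apply: is_interval_measurable => r s /= rm sm t /andP[rt ts].
apply: val_inj; apply/eqP; rewrite eqn_leq -{1}sm -rm.
by rewrite !le_cell.
Qed.

Definition grid_cell {R : realType} {d : nat} (L : nat) (x : d.-tuple R) : grid d L :=
  [ffun i => cell L (tnth x i)].

Lemma measurable_grid_cell {R : realType} {d L : nat} (z : grid d L) :
  measurable [set x : d.-tuple R | grid_cell L x = z].
Proof.
have -> : [set x : d.-tuple R | grid_cell L x = z] =
    \bigcap_(i in setT) ((@tnth _ R ^~ i) @^-1` [set r | cell L r = z i]).
  apply/seteqP; split => x /=; first by move=> <- i _ /=; rewrite ffunE.
  by move=> xz; apply/ffunP => i; rewrite ffunE; exact: xz.
apply: fin_bigcap_measurable => [|i _]; first exact: finite_finset.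
by rewrite -[X in measurable X]setTI; apply: measurable_tnth => //; exact: measurable_cell.
Qed.

Definition node {R : realType} {d : nat} (L : nat) (q : 'I_d -> nat) : d.-tuple R :=
  [tuple (q i)%:R / (2 ^ L)%:R | i < d].

Lemma l1_dist_node {R : realType} {d : nat} (L : nat) (x : d.-tuple R) :
  unit_cube R d x ->
  l1_dist x (node L (grid_point (grid_cell L x))) <= d%:R / (2 ^ L)%:R.
Proof.
move=> x01; rewrite mulr_natl -[X in _ *+ X](card_ord d) -sumr_const.
apply: ler_sum => i _; rewrite tnth_mktuple /grid_point ffunE.
exact: dist_cell.
Qed.

Lemma l1_dist_edge {R : realType} {d L : nat} (q : 'I_d -> nat) (i : 'I_d) :
  l1_dist (node L (set_coord q i (q i).+1)) (node L q) = (2 ^ L)%:R^-1 :> R.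
Proof.
rewrite /l1_dist (bigD1 i)//= big1 ?addr0; last first.
  by move=> k /negbTE ki; rewrite !tnth_mktuple /set_coord ki subrr normr0.
rewrite !tnth_mktuple /set_coord eqxx -mulrBl -natr1 addrAC subrr add0r mul1r.
by rewrite ger0_norm// invr_ge0.
Qed.

(** * From the flows to the expected cost *)
Definition net_flow {R : realType} {d L n : nat}
    (a : {ffun 'I_n -> grid d L * grid d L}) (i : 'I_d) (p : grid d L) : R :=
  \sum_k (flow (a k).1 i p - flow (a k).2 i p).

(** Replacing the points by the nodes of their cells costs at most d / 2 ^ L per
    point; on the nodes, the dual potential has increments at most 1 / 2 ^ L
    along the edges, so only the total mass of the net flow matters. *)
Lemma W1_le_net_flow (R : realType) (d L n : nat) (n_gt0 : (0 < n)%N)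
    (x y : 'I_n -> d.-tuple R) :
  (forall k, unit_cube R d (x k) /\ unit_cube R d (y k)) ->
  (W1 (empirical n_gt0 x) (empirical n_gt0 y) <=
    ((2 ^ L)%:R^-1 * (n%:R^-1 * \sum_i \sum_p
       `|net_flow [ffun k => (grid_cell L (x k), grid_cell L (y k))] i p|
     + 2 * d%:R))%:E)%E.
Proof.
move=> xy01; have [F F_lip] := W1_le_potential n_gt0 x y.
move=> /le_trans; apply; rewrite lee_fin.
have n0 : 0 < n%:R :> R by rewrite ltr0n.
set a := [ffun k => _]; pose f q := F (node L q).
have inc_le i p : `|increment f i p| <= (2 ^ L)%:R^-1.
  rewrite /increment /f (le_trans (F_lip _ _))//.
  by rewrite (l1_dist_edge (grid_point p) i).
have round x' : unit_cube R d x' ->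
    `|F x' - f (grid_point (grid_cell L x'))| <= d%:R / (2 ^ L)%:R.
  by move=> x01; rewrite (le_trans (F_lip _ _))// l1_dist_node.
have roundk k : F (x k) - F (y k) <=
    (f (grid_point (a k).1) - f (grid_point (a k).2)) + 2 * (d%:R / (2 ^ L)%:R).
  have [/round + /round] := xy01 k; rewrite !ffunE/= !ler_norml.
  by move=> /andP[_ ?] /andP[? _]; lra.
have diff k : f (grid_point (a k).1) - f (grid_point (a k).2) =
    \sum_i \sum_p increment f i p * (flow (a k).1 i p - flow (a k).2 i p).
  under eq_bigr do under eq_bigr do rewrite mulrBr.
  under eq_bigr do rewrite sumrB.
  by rewrite sumrB -!flow_divergence; ring.
have sum_diff : \sum_k (f (grid_point (a k).1) - f (grid_point (a k).2)) <=
    (2 ^ L)%:R^-1 * \sum_i \sum_p `|net_flow a i p|.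
  under eq_bigr do rewrite diff.
  rewrite exchange_big mulr_sumr/=; apply: ler_sum => i _.
  rewrite exchange_big mulr_sumr/=; apply: ler_sum => p _.
  rewrite -mulr_sumr; apply: le_trans (ler_norm _) _.
  by rewrite normrM ler_wpM2r.
apply: (@le_trans _ _ (n%:R^-1 * ((2 ^ L)%:R^-1 * (\sum_i \sum_p `|net_flow a i p|) +
    n%:R * (2 * (d%:R / (2 ^ L)%:R))))).
  rewrite ler_wpM2l ?invr_ge0 ?(ltW n0)//.
  apply: le_trans (ler_sum _ (fun k _ => roundk k)) _.
  by rewrite big_split/= lerD// sumr_const card_ord -[leLHS]mulr_natl.
rewrite le_eqVlt; apply/orP; left; apply/eqP; field.
by rewrite !gt_eqF// ltr0n expn_gt0.
Qed.

(** A linearized Cauchy-Schwarz inequality: with a deterministic t, it bounds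
    first moments by second moments before any expectation is taken. *)
Lemma norm_le_sqr {R : realFieldType} (t v : R) : 0 < t ->
  `|v| <= (t + t^-1 * v ^+ 2) / 2.
Proof.
move=> t0; rewrite ler_pdivlMr// -(ler_pM2l t0) [leRHS]mulrDr mulVKf ?gt_eqF//.
rewrite -[v ^+ 2]real_normK ?num_real//.
by have := sqr_ge0 (t - `|v|); rewrite !expr2; nra.
Qed.

(** The growth in L of the energy of the flows, given by [flow_energy]. *)
Definition scale_energy {R : realType} (d L : nat) : R :=
  \sum_(j < L) (2 ^ j)%:R / (2 ^ j)%:R ^+ d.-1.

Section expected_cost.
Context {R : realType} {disp : measure_display} {T : measurableType disp}.
Context (P : probability T R) (d L n : nat) (n_gt0 : (0 < n)%N).
Context (X Y : 'I_n -> {RV P >-> d.-tuple R}).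
Hypothesis XY01 : forall k w, unit_cube R d (X k w) /\ unit_cube R d (Y k w).
Hypothesis XY_indep : pairwise_independent P (fun k w => (X k w, Y k w)).
Hypothesis XY_law : forall k, same_distribution (X k) (Y k).

Let cells w : {ffun 'I_n -> grid d L * grid d L} :=
  [ffun k => (grid_cell L (X k w), grid_cell L (Y k w))].

Let measurable_X (Z : {RV P >-> d.-tuple R}) z :
  measurable [set w | grid_cell L (Z w) = z].
Proof.
rewrite -[X in measurable X]setTI.
exact: (@measurable_funPT _ _ _ _ Z _ _ (measurable_grid_cell z)).
Qed.

Let cells_rect k b : [set w | cells w k = b] =
  (fun w => (X k w, Y k w)) @^-1`
    ([set x | grid_cell L x = b.1] `*` [set y | grid_cell L y = b.2]).
Proof.
apply/seteqP; split => w /=; rewrite ffunE; first by move=> <-.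
by case: b => ? ? [/= -> ->].
Qed.

Let measurable_rect (b : grid d L * grid d L) :
  measurable ([set x : d.-tuple R | grid_cell L x = b.1] `*`
              [set y : d.-tuple R | grid_cell L y = b.2]).
Proof. by apply: measurableX; exact: measurable_grid_cell. Qed.

Let measurable_cells k b : measurable [set w | cells w k = b].
Proof.
have -> : [set w | cells w k = b] =
    [set w | grid_cell L (X k w) = b.1] `&` [set w | grid_cell L (Y k w) = b.2].
  by rewrite cells_rect.
by apply: measurableI; exact: measurable_X.
Qed.

Let indep_cells j k b c : j != k ->
  (P [set w | cells w j = b /\ cells w k = c] =
   P [set w | cells w j = b] * P [set w | cells w k = c])%E.
Proof.
move=> jk; rewrite (cells_rect j b) (cells_rect k c).
rewrite -(XY_indep jk (measurable_rect b) (measurable_rect c)).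
by rewrite -cells_rect -cells_rect.
Qed.

Let cells_law k z :
  P [set w | (cells w k).1 = z] = P [set w | (cells w k).2 = z].
Proof.
have -> : [set w | (cells w k).1 = z] = X k @^-1` [set x | grid_cell L x = z].
  by apply/seteqP; split => w /=; rewrite ffunE.
have -> : [set w | (cells w k).2 = z] = Y k @^-1` [set x | grid_cell L x = z].
  by apply/seteqP; split => w /=; rewrite ffunE.
exact: (XY_law k (measurable_grid_cell z)).
Qed.

Let mean := fin_mean P cells.

Let mean_sqr_net_flow :
  mean (fun a => \sum_i \sum_p (net_flow a i p : R) ^+ 2) <=
  n%:R * (32 * d%:R * scale_energy d L).
Proof.
pose phi (b : grid d L * grid d L) : R :=
  \sum_i \sum_p (flow b.1 i p - flow b.2 i p) ^+ 2.
have -> : mean (fun a => \sum_i \sum_p (net_flow a i p : R) ^+ 2) =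
    \sum_k mean (fun a => phi (a k)).
  rewrite /mean fin_mean_sum.
  under eq_bigr do rewrite fin_mean_sum.
  under [RHS]eq_bigr do rewrite fin_mean_sum.
  rewrite [RHS]exchange_big/=; apply: eq_bigr => i _.
  under [RHS]eq_bigr do rewrite fin_mean_sum.
  rewrite [RHS]exchange_big/=; apply: eq_bigr => p _.
  exact: (mean_sqr_sum measurable_cells indep_cells cells_law (fun z => flow z i p)).
have phi_le b : phi b <= 32 * d%:R * scale_energy d L.
  have E1 := @flow_energy R d L b.1; have E2 := @flow_energy R d L b.2.
  rewrite -/(scale_energy d L) in E1 E2.
  apply: (@le_trans _ _ (\sum_i \sum_p 2 * (flow b.1 i p ^+ 2 + flow b.2 i p ^+ 2))).
    apply: ler_sum => i _; apply: ler_sum => p _.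
    move: (flow b.1 i p) (flow b.2 i p) => u v.
    by have := sqr_ge0 (u + v); rewrite !expr2; nra.
  under eq_bigr do rewrite -mulr_sumr big_split/=.
  by rewrite -mulr_sumr big_split/=; lra.
rewrite mulr_natl -[X in _ *+ X](card_ord n) -sumr_const; apply: ler_sum => k _.
apply: (le_trans (@ler_fin_mean _ _ _ P _ cells (fun a => phi (a k)) _
  (fun a => phi_le (a k)))).
by rewrite (fin_mean_cst P (measurable_joint measurable_cells)).
Qed.

(** Here t is to be chosen of the order of the typical size of the net flow,
    divided by n, through an edge. *)
Lemma expected_W1_le (t : R) : 0 < t ->
  (\int[P]_w W1 (empirical n_gt0 (fun k => X k w)) (empirical n_gt0 (fun k => Y k w))
   <= ((2 ^ L)%:R^-1 * d%:R *
       (2 + ((2 ^ L)%:R ^+ d * t + t^-1 * (32 / n%:R * scale_energy d L)) / 2))%:E)%E.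
Proof.
move=> t0; pose phi (a : {ffun 'I_n -> grid d L * grid d L}) : R :=
  (2 ^ L)%:R^-1 * (n%:R^-1 * \sum_i \sum_p `|net_flow a i p| + 2 * d%:R).
have n0 : 0 < n%:R :> R by rewrite ltr0n.
have phi0 a : 0 <= phi a.
  rewrite mulr_ge0 ?invr_ge0// addr_ge0// mulr_ge0 ?invr_ge0//.
  by apply: sumr_ge0 => i _; exact: sumr_ge0.
apply: (@le_trans _ _ (\int[P]_w (phi (cells w))%:E)%E).
  apply: le_integral_pointwise => w.
    apply: le_ereal_inf_tmp => _ [lambda _ <-].
    by apply: integral_ge0 => z _; rewrite lee_fin sqrtr_ge0.
  exact: W1_le_net_flow.
rewrite (integral_fin_mean P (measurable_joint measurable_cells))// lee_fin.
rewrite -/mean.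
pose psi (a : {ffun 'I_n -> grid d L * grid d L}) : R :=
  (2 ^ L)%:R^-1 * d%:R * (2 + (2 ^ L)%:R ^+ d * t / 2) +
  (2 ^ L)%:R^-1 * (t^-1 * n%:R ^- 2 / 2) * \sum_i \sum_p net_flow a i p ^+ 2.
have phi_le a : phi a <= psi a.
  have sum_cst (c : R) : \sum_(i < d) \sum_(p : grid d L) c = d%:R * ((2 ^ L)%:R ^+ d * c).
    rewrite sumr_const card_ord -[LHS]mulr_natl sumr_const -[X in _ * X]mulr_natl.
    by rewrite -(natrX _ (2 ^ L) d) -card_grid.
  have -> : psi a = (2 ^ L)%:R^-1 * (\sum_(i < d) \sum_(p : grid d L)
      (t + t^-1 * (n%:R^-1 * net_flow a i p) ^+ 2) / 2 + 2 * d%:R).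
    under eq_bigr => i _ do under eq_bigr => p _ do
      rewrite mulrDl exprMn mulrA (mulrAC _ _ 2^-1) exprVn.
    under eq_bigr do rewrite big_split/= -[X in _ + X]mulr_sumr.
    by rewrite big_split/= -[X in _ + X + _]mulr_sumr sum_cst /psi; ring.
  rewrite ler_wpM2l ?invr_ge0// lerD2r mulr_sumr; apply: ler_sum => i _.
  rewrite mulr_sumr; apply: ler_sum => p _.
  apply: le_trans (norm_le_sqr _ t0).
  by rewrite normrM ger0_norm ?invr_ge0// ltW.
apply: (le_trans (ler_fin_mean P cells phi_le)).
rewrite /psi fin_meanD (fin_mean_cst P (measurable_joint measurable_cells)) fin_meanZ.
apply: (@le_trans _ _ ((2 ^ L)%:R^-1 * d%:R * (2 + (2 ^ L)%:R ^+ d * t / 2) +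
  (2 ^ L)%:R^-1 * (t^-1 * n%:R ^- 2 / 2) * (n%:R * (32 * d%:R * scale_energy d L)))).
  rewrite lerD2l ler_wpM2l// !mulr_ge0 ?invr_ge0 ?exprn_ge0// ltW//.
rewrite le_eqVlt; apply/orP; left; apply/eqP; field.
by rewrite !gt_eqF// ltr0n expn_gt0.
Qed.
End expected_cost.


(** * Rates of convergence *)

(** The energy is at most N = 2 ^ L, and N is comparable to n. *)
Lemma cost_bound_dim1 {R : realType} (L n : nat) : (0 < n)%N ->
  (2 ^ L <= n)%N -> (n < 2 * 2 ^ L)%N ->
  (2 ^ L)%:R^-1 * 1%:R * (2 + ((2 ^ L)%:R ^+ 1 * (Num.sqrt n%:R)^-1 +
    (Num.sqrt n%:R)^-1^-1 * (32 / n%:R * scale_energy 1 L)) / 2) <=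
  21 * (1 / Num.sqrt n%:R) :> R.
Proof.
move=> n0 Nn nN; have N0 : 0 < (2 ^ L)%:R :> R by rewrite ltr0n expn_gt0.
have S_le : scale_energy 1 L <= (2 ^ L)%:R :> R.
  rewrite /scale_energy; under eq_bigr do rewrite expr0 divr1.
  rewrite -natr_sum ler_nat; elim: {Nn nN N0} L => [|L IH]; first by rewrite big_ord0.
  by rewrite big_ord_recr/= expnS mul2n -addnn leq_add2r.
have s0 : 0 < Num.sqrt n%:R :> R by rewrite sqrtr_gt0 ltr0n.
have s2 : Num.sqrt n%:R * Num.sqrt n%:R = n%:R :> R by rewrite -expr2 sqr_sqrtr.
have s1 : 1 <= Num.sqrt n%:R :> R by rewrite -[leLHS]sqrtr1 ler_wsqrtr// ler1n.
have : n%:R <= 2 * (2 ^ L)%:R :> R by rewrite -natrM ler_nat ltnW.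
rewrite expr1 invrK mul1r mulr1; move: (Num.sqrt n%:R) s0 s1 s2 => s s0 s1 <-.
move: (2 ^ L)%:R (scale_energy 1 L) N0 S_le => N S N0 SN sN.
rewrite ler_pdivrMl// -(ler_pM2r s0).
have -> : (2 + (N / s + s * (32 / (s * s) * S)) / 2) * s = 2 * s + (N + 32 * S) / 2.
  by field; rewrite gt_eqF.
have -> : N * (21 / s) * s = 21 * N by field; rewrite gt_eqF.
have : s <= 2 * N by nra.
lra.
Qed.

(** The energy is L, which is at most ln n / (2 ln 2) as 4 ^ L <= n. *)
Lemma cost_bound_dim2 {R : realType} (L n : nat) (rho : R) : (2 <= n)%N ->
  ((2 ^ L) ^ 2 <= n)%N -> (n < (2 * 2 ^ L) ^ 2)%N ->
  rho = Num.sqrt (ln n%:R / n%:R) ->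
  (2 ^ L)%:R^-1 * 2%:R * (2 + ((2 ^ L)%:R ^+ 2 * (rho / (2 ^ L)%:R) +
    (rho / (2 ^ L)%:R)^-1 * (32 / n%:R * scale_energy 2 L)) / 2) <=
  (1 + 16 / ln 2 + 8 / Num.sqrt (ln 2)) * rho.
Proof.
move=> n2 Nn nN rhoE; have N0 : 0 < (2 ^ L)%:R :> R by rewrite ltr0n expn_gt0.
have S_eq : scale_energy 2 L = L%:R :> R.
  rewrite /scale_energy (eq_bigr (fun=> 1)) ?sumr_const ?card_ord// => j _.
  by rewrite expr1 divff// pnatr_eq0 -lt0n expn_gt0.
have c0 : 0 < ln 2 :> R by rewrite ln_gt0// ltr1n.
have n0 : 0 < n%:R :> R by rewrite ltr0n; apply: leq_trans n2.
have ln_n : ln 2 <= ln n%:R :> R by rewrite ler_ln ?posrE// ler_nat.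
have L_le : 2 * L%:R * ln 2 <= ln n%:R :> R.
  have -> : 2 * L%:R * ln 2 = ln ((2 ^ L) ^ 2)%:R :> R.
    rewrite -expnM natrX lnXn ?ltr0n// -[RHS]mulr_natl natrM.
    by rewrite [in RHS](mulrC L%:R).
  by rewrite ler_ln ?posrE ?ler_nat// ltr0n !expn_gt0.
have rho_n : rho * rho * n%:R = ln n%:R.
  rewrite -expr2 rhoE sqr_sqrtr ?divfK ?gt_eqF// divr_ge0 ?(ltW n0)//.
  exact: ltW (lt_le_trans c0 ln_n).
have rho0 : 0 < rho by rewrite rhoE sqrtr_gt0 divr_gt0// (lt_le_trans c0).
have n4 : n%:R <= 4 * ((2 ^ L)%:R * (2 ^ L)%:R) :> R.
  rewrite -!natrM ler_nat; apply: leq_trans (ltnW nN) _.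
  by rewrite expnMn -mulnn.
have b0 : 0 < Num.sqrt (ln 2) :> R by rewrite sqrtr_gt0.
have b2 : Num.sqrt (ln 2) * Num.sqrt (ln 2) = ln 2 :> R by rewrite -expr2 sqr_sqrtr// ltW.
rewrite S_eq; move: rho {rhoE} (2 ^ L)%:R L%:R n%:R (ln n%:R) (ln 2) (Num.sqrt (ln 2))
  N0 c0 n0 ln_n L_le rho_n rho0 n4 b0 b2.
move=> r N l k m c b N0 c0 k0 cm lm rk r0 k4 b0 b2 {Nn nN n2}.
have bN : b <= 2 * (N * r).
  have Nr0 : 0 <= 2 * (N * r) by rewrite !mulr_ge0// ltW.
  rewrite -(@ler_pXn2r _ 2%N) ?nnegrE ?(ltW b0)//.
  have : r * r * k <= r * r * (4 * (N * N)) by rewrite ler_pM2l// mulr_gt0.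
  rewrite rk !expr2 b2 => h; move: h cm => /=; nra.
have -> : N^-1 * 2 * (2 + (N ^+ 2 * (r / N) + (r / N)^-1 * (32 / k * l)) / 2) =
    4 / N + r + 32 * r * (l / (r * r * k)).
  by field; rewrite !gt_eqF.
have t1 : 4 / N <= 8 / b * r.
  have -> : 8 / b * r = 8 * r / b by ring.
  by rewrite ler_pdivrMr// mulrAC ler_pdivlMr//; nra.
have t2 : 32 * r * (l / (r * r * k)) <= 16 / c * r.
  rewrite rk.
  have : l / m <= (2 * c)^-1.
    have m0 : 0 < m by exact: lt_le_trans cm.
    by rewrite ler_pdivrMr// ler_pdivlMl ?mulr_gt0//; lra.
  rewrite -(ler_pM2l (_ : 0 < 32 * r)) ?mulr_gt0// => /le_trans; apply.
  rewrite le_eqVlt; apply/orP; left; apply/eqP; field.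
  by rewrite gt_eqF.
lra.
Qed.

(** The scales contribute a geometric series, so the energy is bounded and the
    edges, at most d n of them, determine the rate. *)
Lemma cost_bound_dim_ge3 {R : realType} (d L n : nat) : (3 <= d)%N ->
  ((2 ^ L) ^ d <= n)%N -> (n < (2 * 2 ^ L) ^ d)%N ->
  (2 ^ L)%:R^-1 * d%:R * (2 + ((2 ^ L)%:R ^+ d * (2 ^ L)%:R ^- d +
    ((2 ^ L)%:R ^- d)^-1 * (32 / n%:R * scale_energy d L)) / 2) <=
  70 * d%:R * (1 / (n%:R `^ (1 / d%:R))) :> R.
Proof.
move=> d3 Nn nN; have N0 : 0 < (2 ^ L)%:R :> R by rewrite ltr0n expn_gt0.
have d0 : 0 < d%:R :> R by rewrite ltr0n; apply: leq_trans d3.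
have n0 : 0 < n%:R :> R.
  by rewrite ltr0n; apply: leq_trans Nn; rewrite !expn_gt0.
have S_le : scale_energy d L <= 2 :> R.
  apply: (@le_trans _ _ (2 - (2 ^ L)%:R^-1 * 2)); last by rewrite gerBl mulr_ge0 ?invr_ge0 ?ltW.
  rewrite /scale_energy; elim: L {Nn nN N0} => [|L IH].
    by rewrite big_ord0 expn0 invr1 mul1r subrr.
  rewrite big_ord_recr/=; apply: le_trans (lerD IH (lexx _)) _.
  have M0 : 0 < (2 ^ L)%:R :> R by rewrite ltr0n expn_gt0.
  have : (2 ^ L)%:R / (2 ^ L)%:R ^+ d.-1 <= (2 ^ L)%:R^-1 :> R.
    rewrite ler_pdivrMr ?exprn_gt0// ler_pdivlMl// -expr2.
    rewrite ler_weXn2l ?ler1n ?expn_gt0//.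
    by lia.
  rewrite expnS natrM invfM; lra.
have nd : n%:R `^ (1 / d%:R) <= 2 * (2 ^ L)%:R :> R.
  have N20 : 0 <= 2 * (2 ^ L)%:R :> R by rewrite mulr_ge0// ltW.
  have d1 : d%:R * (1 / d%:R) = 1 :> R by rewrite mul1r divff// gt_eqF.
  have -> : 2 * (2 ^ L)%:R = ((2 * (2 ^ L)%:R) ^+ d) `^ (1 / d%:R) :> R.
    by rewrite -powR_mulrn// -powRrM d1 powRr1.
  apply: ge0_ler_powR; rewrite ?nnegrE ?divr_ge0 ?(ltW n0) ?(ltW d0) ?exprn_ge0//.
  by rewrite -natrM -natrX ler_nat ltnW.
have nu0 : 0 < n%:R `^ (1 / d%:R) :> R by rewrite powR_gt0.
have Md : (2 ^ L)%:R ^+ d <= n%:R :> R by rewrite -natrX ler_nat.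
have M0 : 0 < (2 ^ L)%:R ^+ d :> R by rewrite exprn_gt0.
rewrite invrK divff ?gt_eqF//.
have e64 : (2 ^ L)%:R ^+ d * (32 / n%:R * scale_energy d L) <= 64 :> R.
  rewrite mulrA mulrCA -mulrA -[leRHS](_ : 32 * (1 * 2) = 64); last by ring.
  rewrite ler_wpM2l// ler_pM ?divr_ge0 ?(ltW M0) ?(ltW n0)//.
    by apply: sumr_ge0 => j _; rewrite divr_ge0// exprn_ge0.
  by rewrite ler_pdivrMr// mul1r.
apply: (@le_trans _ _ ((2 ^ L)%:R^-1 * d%:R * 35)).
  by rewrite ler_wpM2l ?mulr_ge0 ?invr_ge0 ?(ltW N0) ?(ltW d0)//; lra.
have -> : 70 * d%:R * (1 / n%:R `^ (1 / d%:R)) =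
    2 / n%:R `^ (1 / d%:R) * (d%:R * 35) :> R by ring.
rewrite -mulrA ler_wpM2r ?mulr_ge0 ?(ltW d0)//.
by rewrite ler_pdivlMr// ler_pdivrMl// [leRHS]mulrC.
Qed.

Theorem theorem3 (R : realType) (d : nat) (d_ge1 : (1 <= d)%N) :
  exists C : R,
  forall (disp : measure_display) (T : measurableType disp)
    (P : probability T R) (n : nat) (n_ge2 : (2 <= n)%N)
    (X Y : 'I_n -> {RV P >-> d.-tuple R}),
  (forall k w, unit_cube R d (X k w) /\ unit_cube R d (Y k w)) ->
  pairwise_independent P (fun k w => (X k w, Y k w)) ->
  (forall k, same_distribution (X k) (Y k)) ->
  (\int[P]_w W1 (empirical (ltnW n_ge2) (fun k => X k w))
                (empirical (ltnW n_ge2) (fun k => Y k w))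
   <= (C * transport_rate R d n)%:E)%E.
Proof.
suff [C HC] : exists C : R, forall n, (2 <= n)%N -> exists L t, 0 < t /\
    (2 ^ L)%:R^-1 * d%:R * (2 + ((2 ^ L)%:R ^+ d * t +
      t^-1 * (32 / n%:R * scale_energy d L)) / 2) <= C * transport_rate R d n.
  exists C => disp T P n n_ge2 X Y XY01 XY_indep XY_law.
  have [L [t [t0 le_rate]]] := HC n n_ge2.
  apply: le_trans (expected_W1_le L (ltnW n_ge2) XY01 XY_indep XY_law t0) _.
  by rewrite lee_fin.
(* The finest grid with at most n cells. *)
have scale n : (2 <= n)%N -> exists L, ((2 ^ L) ^ d <= n < (2 * 2 ^ L) ^ d)%N.
  move=> n2; exists (trunc_log (2 ^ d) n).
  rewrite -expnS -!expnM ![(_ * d)%N]mulnC !expnM.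
  by apply: trunc_log_bounds; [rewrite -{1}(expn0 2) ltn_exp2l|exact: ltnW].
rewrite /transport_rate; case: eqP => [->|/eqP d_neq1] in scale *; last case: eqP => [->|/eqP d_neq2] in scale *.
- exists 21 => n n2; have [L] := scale n n2; rewrite !expn1 => /andP[Nn nN].
  exists L, (Num.sqrt n%:R)^-1; split; first by rewrite invr_gt0 sqrtr_gt0 ltr0n ltnW.
  by apply: cost_bound_dim1 => //; exact: ltnW.
- exists (1 + 16 / ln 2 + 8 / Num.sqrt (ln 2)) => n n2.
  have [L /andP[Nn nN]] := scale n n2.
  exists L, (Num.sqrt (ln n%:R / n%:R) / (2 ^ L)%:R); split.
    rewrite divr_gt0// ?ltr0n ?expn_gt0// sqrtr_gt0 divr_gt0// ?ltr0n ?(ltnW n2)//.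
    by rewrite ln_gt0// ltr1n.
  exact: cost_bound_dim2.
- exists (70 * d%:R) => n n2; have [L /andP[Nn nN]] := scale n n2.
  exists L, ((2 ^ L)%:R ^- d); split.
    by rewrite invr_gt0 exprn_gt0// ltr0n expn_gt0.
  by apply: cost_bound_dim_ge3 => //; lia.
Qed.
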